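(* Fix a finite number $E$ of observed environments $\mathcal{E}_{obs}=\{1,\dots,E\}$ and take the collection of environments of interest to be $\mathcal{E}=\mathcal{E}_{obs}$, with $p(e)$ the uniform distribution on $\mathcal{E}_{obs}$. In the setting described in the context, assume: (Invariance) there exists $z^*\in\{0,1\}^p$ such that $p_e(y\mid x^{z^*})$ is the same for all $e\in\mathcal{E}_{obs}$; (Uniqueness) this $z^*$ is unique; (Prior positivity) $p(z^* )>0$; (Estimation consistency given fixed environments) for every $z$ with $p(z)>0$, as $n\to\infty$, $$\frac{1}{nE}\sum_{i=1}^n\sum_{e=1}^E\log\hat p_e(y_{ei}\mid x_{ei}^z)\xrightarrow{P}\mathbb{E}_{p(e)p_e(y,x^z)}[\log p_e(y\mid x^z)],\qquad \frac{1}{nE}\sum_{i=1}^n\sum_{e=1}^E\log\hat g(y_{ei}\mid x_{ei}^z)\xrightarrow{P}\mathbb{E}_{p(e)p_e(y,x^z)}[\log g(y\mid x^z)];$$ (Finite variance) for every $z$ with $p(z)>0$, $\mathrm{Var}_{p(e)p_e(y,x^z)}\big(\log p_e(y\mid x^z)-\log g(y\mid x^z)\big)<\infty$. Let $\kappa\in(0,1)$ be fixed. Then there exists a sequence $\epsilon_{n,E}=O(R\,e^{-\kappa nE\mu_{\min}})$ such that $P\big(\mathrm{TV}(\hat p(z\mid\mathcal{D}),\delta_{z^*}(z))>\epsilon_{n,E}\big)\to 0$ as $n\to\infty$, where $R:=\Big(\max_{z\neq z^*}\frac{p(z)}{p(z^* )}\Big)\cdot|\mathrm{supp}\,p(z)|$,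 $\mu(z):=\mathbb{E}_{p(e)p_e(x^z)}\big[\mathrm{KL}(p_e(y\mid x^z)\,\|\,g(y\mid x^z))\big]$ and $\mu_{\min}:=\min_{z\neq z^*,\,p(z)>0}\mu(z)$.
   Context: Features $x\in\mathbb{R}^p$, outcome $y$. For $z\in\{0,1\}^p$, $x^z$ is the subvector of coordinates $j$ with $z^{(j)}=1$ and $x^{-z}$ the rest. Each environment $e$ has a joint density $p_e(x,y)$, from which $p_e(x^z)$, $p_e(y\mid x^z)$ are derived. The pooled conditional is $g(y\mid x^z):=\frac{\sum_{e=1}^E\int p_e(x,y)\,\mathrm{d}x^{-z}}{\sum_{e=1}^E p_e(x^z)}$. Data: in each environment $e=1,\dots,E$, $n$ i.i.d. observations $(x_{ei},y_{ei})$ from $p_e(x,y)$; $\mathcal{D}$ is all data. A prior $p(z)$ on $\{0,1\}^p$ is given. For each $z$ a model class $\mathcal{P}_{y\mid x^z}$ is fixed; $\hat p_e(y\mid x^z)$ maximizes $\sum_{i=1}^n\log\tilde p(y_{ei}\mid x_{ei}^z)$ and $\hat g(y\mid x^z)$ maximizes $\sum_{e=1}^E\sum_{i=1}^n\log\tilde p(y_{ei}\mid x_{ei}^z)$ over $\tilde p\in\mathcal{P}_{y\mid x^z}$. The estimated BIP posterior is $\hat p(z\mid\mathcal{D})\propto p(z)\prod_{e=1}^E\prod_{i=1}^n\frac{\hat g(y_{ei}\mid x_{ei}^z)}{\hat p_e(y_{ei}\mid x_{ei}^z)}$. $\delta_{z^*}$ is the point mass at $z^*$ and $\mathrm{TV}(\hat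 p(z\mid\mathcal{D}),\delta_{z^*})=1-\hat p(z^*\mid\mathcal{D})$. *)

(* Defs.v *)
From HB Require Import structures.
From mathcomp Require Import all_boot all_order all_algebra.
From mathcomp Require Import all_classical all_reals all_analysis.
Set Implicit Arguments. Unset Strict Implicit. Unset Printing Implicit Defensive.
Import Order.TTheory GRing.Theory Num.Theory.
Import numFieldNormedType.Exports.
Local Open Scope classical_set_scope.
Local Open Scope ring_scope.

(* Features x live in R^p, represented as p.-tuple R (with MathComp-Analysis'
   product sigma-algebra on tuples); outcomes y live in R.
   Lebesgue measure on R^p is realised by iterated one-dimensional Lebesgue
   integrals over the coordinates (Tonelli; used only on nonnegative
   integrands, signed integrands are split into positive / negative parts). *)

Section BIP.
Variable R : realType.
Variable p : nat.

Definition lebR := @lebesgue_measure R.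

Definition setc (x : p.-tuple R) (j : 'I_p) (t : R) : p.-tuple R :=
  [tuple (if i == j then t else tnth x i) | i < p].

Definition intC (S : seq 'I_p) (f : p.-tuple R -> \bar R) : p.-tuple R -> \bar R :=
  foldr (fun j h x => (\int[lebR]_t h (setc x j t))%E) f S.

Definition x0 : p.-tuple R := [tuple (0 : R) | i < p].

Definition intX (f : p.-tuple R -> \bar R) : \bar R := intC (enum 'I_p) f x0.
Definition intXY (f : p.-tuple R -> R -> \bar R) : \bar R :=
  intX (fun x => (\int[lebR]_y f x y)%E).

Definition epos (a : \bar R) : \bar R := Order.max a 0%E.
Definition eneg (a : \bar R) : \bar R := Order.max (- a)%E 0%E.

Definition sintX (f : p.-tuple R -> \bar R) : \bar R :=
  (intX (fun x => epos (f x)) - intX (fun x => eneg (f x)))%E.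
Definition sintXY (f : p.-tuple R -> R -> \bar R) : \bar R :=
  (intXY (fun x y => epos (f x y)) - intXY (fun x y => eneg (f x y)))%E.

Definition elog (a : R) : \bar R := if 0 < a then (ln a)%:E else -oo%E.

Definition zset := {ffun 'I_p -> bool}.

Definition offz (z : zset) : seq 'I_p := [seq j <- enum 'I_p | ~~ z j].

Definition agree_on (z : zset) (x x' : p.-tuple R) : Prop :=
  forall j, z j -> tnth x j = tnth x' j.

Definition cond_density (z : zset) (q : p.-tuple R -> R -> R) : Prop :=
  [/\ forall x x', agree_on z x x' -> q x = q x',
      forall x y, 0 <= q x y,
      measurable_fun setT (fun xy : p.-tuple R * R => q xy.1 xy.2) &
      forall x, (\int[lebR]_y (q x y)%:E = 1)%E].

Definition joint_density (f : p.-tuple R -> R -> R) : Prop :=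
  [/\ forall x y, 0 <= f x y,
      measurable_fun setT (fun xy : p.-tuple R * R => f xy.1 xy.2) &
      intXY (fun x y => (f x y)%:E) = 1%E].

Variable E : nat.
Variable dens : 'I_E -> p.-tuple R -> R -> R.

(* p_e(x^z, y), as a function of (x,y) depending only on x^z *)
Definition margz (e : 'I_E) (z : zset) (x : p.-tuple R) (y : R) : \bar R :=
  intC (offz z) (fun x' => (dens e x' y)%:E) x.
Definition pxz (e : 'I_E) (z : zset) (x : p.-tuple R) : \bar R :=
  (\int[lebR]_y margz e z x y)%E.
Definition px (e : 'I_E) (x : p.-tuple R) : \bar R :=
  (\int[lebR]_y (dens e x y)%:E)%E.
Definition pcond (e : 'I_E) (z : zset) (x : p.-tuple R) (y : R) : R :=
  fine (margz e z x y) / fine (pxz e z x).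
Definition gpool (z : zset) (x : p.-tuple R) (y : R) : R :=
  fine (\sum_(e < E) margz e z x y)%E / fine (\sum_(e < E) pxz e z x)%E.

Definition mixE (F : 'I_E -> p.-tuple R -> R -> \bar R) : \bar R :=
  ((E%:R)^-1%:E * \sum_(e < E) sintXY (fun x y => (dens e x y)%:E * F e x y))%E.
Definition mixVar (F : 'I_E -> p.-tuple R -> R -> \bar R) : \bar R :=
  mixE (fun e x y => (F e x y - mixE F) * (F e x y - mixE F))%E.

(* invariance of p_e(y | x^z) across environments: one conditional density
   q(y|x^z) is a version of p_e(y|x^z) for every e (p_e-almost everywhere) *)
Definition env_invariant (z : zset) : Prop :=
  exists q, cond_density z q /\
    forall e : 'I_E,
      intXY (fun x y => (dens e x y)%:E * ((pcond e z x y != q x y)%:R)%:E)%E = 0%E.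

Definition KL (e : 'I_E) (z : zset) (x : p.-tuple R) : \bar R :=
  (\int[lebR]_y ((pcond e z x y)%:E *
                (elog (pcond e z x y) - elog (gpool z x y))))%E.

Definition muz (z : zset) : \bar R :=
  ((E%:R)^-1%:E * \sum_(e < E) sintX (fun x => px e x * KL e z x))%E.

End BIP.

Definition mutually_indep {R : realType} {d} {Om : measurableType d}
  {dT} {T : measurableType dT} {I : eqType}
  (P : probability Om R) (X : I -> Om -> T) : Prop :=
  forall (s : seq I) (A : I -> set T), uniq s -> (forall k, measurable (A k)) ->
    P [set w | forall k, k \in s -> X k w \in A k] =
    (\prod_(k <- s) P (X k @^-1` A k))%E.

Definition cvg_in_prob {R : realType} {d} {Om : measurableType d}
  (P : probability Om R) (X : nat -> Om -> \bar R) (L : \bar R) : Prop :=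
  L \is a fin_num /\
  forall eps : R, 0 < eps ->
    P [set w | ~ (X n w \is a fin_num /\ `|fine (X n w) - fine L| < eps)]
      @[n --> \oo] --> 0%E.

Definition tvd {R : realType} {T : finType} (q r : T -> R) : R :=
  2^-1 * \sum_(t : T) `|q t - r t|.

(* Main.v *)
Require Import Defs.
From HB Require Import structures.
From mathcomp Require Import all_boot all_order all_algebra.
From mathcomp Require Import all_classical all_reals all_analysis.
From mathcomp Require Import measurable_realfun ring lra.
Import Order.TTheory GRing.Theory Num.Theory.
Import numFieldNormedType.Exports.
Local Open Scope classical_set_scope.
Local Open Scope ring_scope.

(** Let [lp] and [lg] be the population means of [log p_e(y | x^z)] and of
    [log g(y | x^z)].  By Tonelli the excess KL risk [muz z] equals [lp - lg]
    as soon as both means are finite, which consistency provides.  At the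
    invariant [z*] one needs [lp <= lg]: if [q] is the common version of the
    conditionals, then [log (q / g) <= q / g - 1], and the [p_e]-means of
    [q / g] add up to at most [E].  Outside an event of vanishing probability
    every log-likelihood ratio of a supported [z] is therefore within
    [2 n E eta] of [- n E (lp - lg)], so for [4 eta = (1 - kappa) mu_min] each
    posterior odds against [z*] is at most its prior odds times
    [exp (- kappa n E mu_min)].  When [mu_min <= 0] the bound [TV <= 1] is
    already enough. *)

(** * Iterated nonnegative Lebesgue integrals over a list of coordinates *)

Section IteratedIntegral.
Context {R : realType} {p : nat}.
Local Open Scope ereal_scope.
Implicit Types (S : seq 'I_p) (j : 'I_p).

Lemma setcC (x : p.-tuple R) i j s t : i != j ->
  setc (setc x i s) j t = setc (setc x j t) i s.
Proof.
move=> ij; apply: eq_from_tnth => k; rewrite !tnth_mktuple.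
by have [->|//] := eqVneq k j; rewrite eq_sym (negbTE ij).
Qed.

Lemma measurable_setc j d (U : measurableType d)
    (f : U -> p.-tuple R) (g : U -> R) :
  measurable_fun setT f -> measurable_fun setT g ->
  measurable_fun setT (fun u => setc (f u) j (g u)).
Proof.
move=> mf mg; apply/measurable_fun_tnthP => i.
have [eij|nij] := eqVneq i j.
  apply: (eq_measurable_fun g) => // u _.
  by rewrite /= tnth_mktuple eij eqxx.
apply: (eq_measurable_fun (fun u => tnth (f u) i)).
  by move=> u _; rewrite /= tnth_mktuple (negbTE nij).
apply: (measurableT_comp (f := fun x => tnth x i)) => //.
exact: measurable_tnth.
Qed.

Lemma intC_ge0 S (f : p.-tuple R -> \bar R) :
  (forall x, 0 <= f x) -> forall x, 0 <= intC S f x.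
Proof.
move=> f0; elim: S => [//|j S IH] x /=.
by apply: integral_ge0 => t _; exact: IH.
Qed.

(** The parameter [u] makes room for the outcome [y]: margins and Fubini exchanges need
    measurability jointly in [(x, y)]. Each coordinate is added by Tonelli. *)
Lemma measurable_intC_param S d (U : measurableType d)
    (f : p.-tuple R * U -> \bar R) :
  measurable_fun setT f -> (forall xu, 0 <= f xu) ->
  measurable_fun setT (fun xu => intC S (fun x => f (x, xu.2)) xu.1).
Proof.
move=> mf f0; elim: S => [|j S IH] /=.
  by apply: (eq_measurable_fun f) => // -[].
pose h (a : (p.-tuple R * U) * R) :=
  intC S (fun x => f (x, a.1.2)) (setc a.1.1 j a.2).
apply: (measurable_fun_fubini_tonelli_F (m2 := @lebesgue_measure R) h).
- apply: (measurableT_comp (g := fun a : (p.-tuple R * U) * R =>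
     (setc a.1.1 j a.2, a.1.2)) IH).
  apply/measurable_fun_pair => /=.
    apply: measurable_setc => //.
    by apply: measurableT_comp.
  by apply: measurableT_comp.
- by move=> a; apply: intC_ge0.
Qed.

Lemma measurable_intC S (f : p.-tuple R -> \bar R) :
  measurable_fun setT f -> (forall x, 0 <= f x) ->
  measurable_fun setT (intC S f).
Proof.
move=> mf f0.
have mF : measurable_fun setT (f \o @fst (p.-tuple R) R).
  exact: (measurableT_comp mf measurable_fst).
have mS := @measurable_intC_param S _ R _ mF (fun _ => f0 _).
apply: (measurableT_comp (g := fun x => (x, 0%R : R)) mS).
by apply: measurable_fun_pair => //; exact: measurable_cst.
Qed.

Lemma measurable_intC_setc S j (f : p.-tuple R -> \bar R) (x : p.-tuple R) :
  measurable_fun setT f -> (forall x, 0 <= f x) ->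
  measurable_fun setT (fun t : R => intC S f (setc x j t)).
Proof.
move=> mf f0; apply: measurableT_comp; first exact: measurable_intC.
by apply: measurable_setc => //; exact: measurable_cst.
Qed.

Lemma eq_intC S (f g : p.-tuple R -> \bar R) : f =1 g -> intC S f =1 intC S g.
Proof. by move=> /funext ->. Qed.

Lemma le_intC S (f g : p.-tuple R -> \bar R) :
  measurable_fun setT f -> measurable_fun setT g -> (forall x, 0 <= f x) ->
  (forall x, f x <= g x) -> forall x, intC S f x <= intC S g x.
Proof.
move=> mf mg f0 fg; have g0 x : 0 <= g x by exact: le_trans (fg x).
elim: S => [//|j S IH] x /=; apply: ge0_le_integral => //=.
- by move=> t _; exact: intC_ge0.
- exact: measurable_intC_setc.
- exact: measurable_intC_setc.
Qed.

Lemma intCD S (f g : p.-tuple R -> \bar R) :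
  measurable_fun setT f -> measurable_fun setT g ->
  (forall x, 0 <= f x) -> (forall x, 0 <= g x) ->
  forall x, intC S (fun x => f x + g x) x = intC S f x + intC S g x.
Proof.
move=> mf mg f0 g0; elim: S => [//|j S IH] x /=.
under eq_integral do rewrite IH.
rewrite ge0_integralD//.
- by move=> t _; exact: intC_ge0.
- exact: measurable_intC_setc.
- by move=> t _; exact: intC_ge0.
- exact: measurable_intC_setc.
Qed.

Lemma intC0 S x : intC S (fun=> 0 : \bar R) x = 0.
Proof.
elim: S x => [//|j S IH] x /=.
by under eq_integral do rewrite IH; rewrite integral0.
Qed.

Lemma intC_sum S (I : Type) (s : seq I) (f : I -> p.-tuple R -> \bar R) :
  (forall i, measurable_fun setT (f i)) -> (forall i x, 0 <= f i x) ->
  forall x, intC S (fun x => \sum_(i <- s) f i x) x =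
            \sum_(i <- s) intC S (f i) x.
Proof.
move=> mf f0; elim: s => [|i s IH] x.
  rewrite big_nil -[RHS](intC0 S x).
  by apply: eq_intC => y; rewrite big_nil.
rewrite big_cons -IH -intCD//.
- by apply: eq_intC => y; rewrite big_cons.
- exact: emeasurable_sum.
- by move=> y; apply: sume_ge0.
Qed.

Lemma intCZr S (f g : p.-tuple R -> \bar R) :
  measurable_fun setT f -> (forall x, 0 <= f x) -> (forall x, 0 <= g x) ->
  (forall x j t, j \in S -> g (setc x j t) = g x) ->
  forall x, intC S (fun x => f x * g x) x = intC S f x * g x.
Proof.
move=> mf f0 g0; elim: S => [//|j S IH] gS x /=.
have gS' y i t : i \in S -> g (setc y i t) = g y.
  by move=> iS; rewrite gS// inE iS orbT.
under eq_integral do rewrite IH// gS ?mem_head//.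
rewrite ge0_integralZr//.
- exact: measurable_intC_setc.
- by move=> t _; exact: intC_ge0.
Qed.

(** Monotone convergence once per coordinate; [le_intC] keeps the inner integrals increasing. *)
Lemma intC_lim S (g : nat -> p.-tuple R -> \bar R) :
  (forall n, measurable_fun setT (g n)) -> (forall n x, 0 <= g n x) ->
  (forall x, nondecreasing_seq (g ^~ x)) ->
  forall x, intC S (fun x => limn (g ^~ x)) x = limn (fun n => intC S (g n) x).
Proof.
move=> mg g0 ndg; elim: S => [//|j S IH] x /=.
under eq_integral do rewrite IH.
rewrite monotone_convergence//.
- by move=> n; exact: measurable_intC_setc.
- by move=> n t _; exact: intC_ge0.
- by move=> t _ m n mn; apply: le_intC => // y; exact: ndg.
Qed.

Lemma intC_fubini S (f : p.-tuple R * R -> \bar R) :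
  measurable_fun setT f -> (forall xy, 0 <= f xy) ->
  forall x, \int[@lebR R]_y intC S (fun x => f (x, y)) x =
            intC S (fun x => \int[@lebR R]_y f (x, y)) x.
Proof.
move=> mf f0; elim: S => [//|j S IH] x /=.
under [RHS]eq_integral do rewrite -IH.
pose h (yt : R * R) := intC S (fun x' => f (x', yt.1)) (setc x j yt.2).
apply: (fubini_tonelli (m1 := @lebesgue_measure R)
  (m2 := @lebesgue_measure R) h).
- apply: (measurableT_comp (g := fun yt : R * R => (setc x j yt.2, yt.1))
    (measurable_intC_param S _ _ _ mf f0)).
  apply/measurable_fun_pair => //=.
  by apply: measurable_setc => //; exact: measurable_cst.
- by move=> yt; apply: intC_ge0.
Qed.

Lemma intC_setc S j (f : p.-tuple R -> \bar R) t : j \notin S ->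
  forall x, intC S f (setc x j t) = intC S (fun x => f (setc x j t)) x.
Proof.
elim: S => [//|i S IH]; rewrite inE negb_or => /andP[ji jS] x /=.
by apply: eq_integral => s _; rewrite setcC// IH.
Qed.

(** The head of the list is the outermost integral, so a head outside [a] must travel inward past
    the [a]-coordinates. [intC_fubini] moves it, with coordinate [j] in the role of [y]; [uniq S]
    makes setting [j] commute with the integrals it passes. *)
Lemma intC_filter (a : pred 'I_p) S (f : p.-tuple R -> \bar R) : uniq S ->
  measurable_fun setT f -> (forall x, 0 <= f x) ->
  forall x, intC S f x =
    intC [seq j <- S | a j] (intC [seq j <- S | ~~ a j] f) x.
Proof.
move=> + mf f0; elim: S => [//|j S IH] /= /andP[jS /IH {}IH] x.
case: (a j) => /=; first by apply: eq_integral => t _; exact: IH.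
have jS' : j \notin [seq j <- S | a j].
  by apply: contra jS; rewrite mem_filter => /andP[].
under eq_integral do rewrite IH (intC_setc _ _ _ _ jS').
rewrite (intC_fubini _
  (fun xt => intC [seq j <- S | ~~ a j] f (setc xt.1 j xt.2)))//.
- apply: measurableT_comp; first exact: measurable_intC.
  exact: measurable_setc.
- by move=> xt; exact: intC_ge0.
Qed.

End IteratedIntegral.

(** * Recognising a functional as the integral against a measure *)

Section FunctionalIntegral.
Context {R : realType} d {T : measurableType d} (m : {measure set T -> \bar R}).
Local Open Scope ereal_scope.
Import HBNNSimple.

(** The standard extension from indicators to simple functions to increasing limits. It serves for
    [J h = intXY (dens e * h)], which turns iterated integrals into integrals against the law of an
    observation. *)
Lemma functional_integral (J : (T -> \bar R) -> \bar R) :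
  (forall A, measurable A -> J (fun x => (\1_A x)%:E) = m A) ->
  (forall f g, measurable_fun setT f -> measurable_fun setT g ->
     (forall x, 0 <= f x) -> (forall x, 0 <= g x) ->
     J (fun x => f x + g x) = J f + J g) ->
  (forall (c : R) f, (0 <= c)%R -> measurable_fun setT f ->
     (forall x, 0 <= f x) ->
     J (fun x => c%:E * f x) = c%:E * J f) ->
  (forall g : nat -> T -> \bar R, (forall n, measurable_fun setT (g n)) ->
     (forall n x, 0 <= g n x) -> (forall x, nondecreasing_seq (g ^~ x)) ->
     J (fun x => limn (g ^~ x)) = limn (fun n => J (g n))) ->
  forall f, measurable_fun setT f -> (forall x, 0 <= f x) ->
  J f = \int[m]_x f x.
Proof.
move=> J1 JD JZ Jlim f mf f0.
have J0 : J (fun=> 0) = 0.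
  transitivity (J (fun x => (\1_set0 x)%:E)); last by rewrite J1// measure0.
  by congr J; apply/funext => x; rewrite indic0.
have Jsum (I : Type) (s : seq I) (c : I -> R) (A : I -> set T) :
    (forall i, 0 <= c i)%R -> (forall i, measurable (A i)) ->
    J (fun x => \sum_(i <- s) (c i)%:E * (\1_(A i) x)%:E) =
    \sum_(i <- s) (c i)%:E * m (A i).
  move=> c0 mA.
  have mcA i : measurable_fun setT (fun x => (c i)%:E * (\1_(A i) x)%:E).
    by apply: measurable_funeM; apply/measurable_EFinP; exact: measurable_indic.
  have cA0 i x : 0 <= (c i)%:E * (\1_(A i) x)%:E by rewrite mule_ge0// lee_fin.
  elim: s => [|i s IH].
    by rewrite big_nil -[RHS]J0; congr J; apply/funext => x; rewrite big_nil.
  have mI : measurable_fun setT (fun x => (\1_(A i) x)%:E : \bar R).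
    by apply/measurable_EFinP; exact: measurable_indic.
  have I0 x : 0 <= (\1_(A i) x)%:E :> \bar R by rewrite lee_fin.
  rewrite big_cons -IH -J1// -JZ// -JD//.
  - by congr J; apply/funext => x; rewrite big_cons.
  - exact: emeasurable_sum.
  - by move=> x; exact: sume_ge0.
have Jnn (h : {nnsfun T >-> R}) : J (fun x => (h x)%:E) = \int[m]_x (h x)%:E.
  (* [Jsum] asks for a nonnegative coefficient at every real index, so the values of [h] enter as
     [|r|], which agrees with [r] on the range. *)
  have hr (r : R) : r \in range h -> `|r|%R = r.
    by rewrite inE => -[x _ <-]; rewrite ger0_norm.
  rewrite integral_nnsfun// patch_setT sintegralE fsbig_finite//=.
  transitivity (\sum_(r <- finmap.enum_fset (fset_set (range h)))
    `|r|%:E * m (h @^-1` [set r])).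
    rewrite -(Jsum R _ (fun r => `|r|%R) (fun r => h @^-1` [set r]))//.
    congr J; apply/funext => x; rewrite fimfunE fsbig_finite//= -sumEFin.
    rewrite big_seq [RHS]big_seq; apply: eq_bigr => r.
    by rewrite in_fset_set// => /hr ->; rewrite EFinM.
  rewrite big_seq [RHS]big_seq; apply: eq_bigr => r.
  by rewrite in_fset_set// => /hr ->.
pose f_ := nnsfun_approx measurableT mf.
have f_lim x : f x = limn (fun n => (f_ n x)%:E).
  by apply/esym/cvg_lim => //=; exact: cvg_nnsfun_approx.
rewrite (_ : f = fun x => limn (fun n => (f_ n x)%:E)); last exact/funext.
have nd_f x : nondecreasing_seq (fun n => (f_ n x)%:E).
  by move=> a b ab; rewrite lee_fin; exact/lefP/nd_nnsfun_approx.
rewrite (Jlim (fun n x => (f_ n x)%:E))//; last first.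
- by move=> n x; rewrite lee_fin.
- by move=> n; exact/measurable_EFinP.
rewrite monotone_convergence//; last first.
- by move=> n x _; rewrite lee_fin.
- by move=> n; exact/measurable_EFinP.
by congr (limn _); apply/funext => n; exact: Jnn.
Qed.
End FunctionalIntegral.

(** * Integrals over features and outcome; positive and negative parts *)

Section JointIntegral.
Context {R : realType} {p : nat}.
Local Open Scope ereal_scope.
Implicit Types f g : p.-tuple R * R -> \bar R.

Lemma measurable_int_y f : measurable_fun setT f -> (forall u, 0 <= f u) ->
  measurable_fun setT (fun x => \int[@lebR R]_y f (x, y)).
Proof.
move=> mf f0.
exact: (measurable_fun_fubini_tonelli_F (m2 := @lebesgue_measure R) f).
Qed.

Lemma measurable_slice f x : measurable_fun setT f ->
  measurable_fun setT (fun y : R => f (x, y)).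
Proof. by move=> mf; exact: measurableT_comp. Qed.

Lemma intXYD f g : measurable_fun setT f -> measurable_fun setT g ->
  (forall u, 0 <= f u) -> (forall u, 0 <= g u) ->
  intXY (fun x y => f (x, y) + g (x, y)) =
  intXY (fun x y => f (x, y)) + intXY (fun x y => g (x, y)).
Proof.
move=> mf mg f0 g0; rewrite /intXY /intX -intCD//.
- apply: eq_intC => x; rewrite ge0_integralD//; exact: measurable_slice.
- exact: measurable_int_y.
- exact: measurable_int_y.
- by move=> x; exact: integral_ge0.
- by move=> x; exact: integral_ge0.
Qed.

Lemma intXYZ (c : R) f : (0 <= c)%R -> measurable_fun setT f ->
  (forall u, 0 <= f u) ->
  intXY (fun x y => c%:E * f (x, y)) = c%:E * intXY (fun x y => f (x, y)).
Proof.
move=> c0 mf f0; rewrite /intXY /intX muleC -(intCZr _ _ (fun=> c%:E))//.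
- apply: eq_intC => x; rewrite ge0_integralZl ?lee_fin// 1?muleC//.
  exact: measurable_slice.
- exact: measurable_int_y.
- by move=> x; exact: integral_ge0.
Qed.

Lemma intXY_lim (g : nat -> p.-tuple R * R -> \bar R) :
  (forall n, measurable_fun setT (g n)) -> (forall n u, 0 <= g n u) ->
  (forall u, nondecreasing_seq (g ^~ u)) ->
  intXY (fun x y => limn (g ^~ (x, y))) =
  limn (fun n => intXY (fun x y => g n (x, y))).
Proof.
move=> mg g0 ndg.
rewrite /intXY /intX -(intC_lim _ (fun n x => \int[@lebR R]_y g n (x, y))).
- apply: eq_intC => x.
  apply: (@monotone_convergence _ _ _ (@lebesgue_measure R) setT _
    (fun n y => g n (x, y))) => //.
  by move=> n; exact: measurable_slice.
- by move=> n; exact: measurable_int_y.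
- by move=> n x; exact: integral_ge0.
- move=> x m n mn; apply: ge0_le_integral => //.
  + exact: measurable_slice.
  + exact: measurable_slice.
  + by move=> y _; exact: ndg.
Qed.

Lemma epos_ge0 (a : \bar R) : 0 <= epos a.
Proof. by rewrite /epos le_max lexx orbT. Qed.

Lemma eneg_ge0 (a : \bar R) : 0 <= eneg a.
Proof. by rewrite /eneg le_max lexx orbT. Qed.

Lemma eposM (a b : \bar R) : 0 <= a -> epos (a * b) = a * epos b.
Proof.
move=> a0; rewrite /epos; have [b0|/ltW b0] := leP 0 b.
  by rewrite !max_l// mule_ge0.
by rewrite !max_r// ?mule0// mule_ge0_le0.
Qed.

Lemma enegM (a b : \bar R) : 0 <= a -> eneg (a * b) = a * eneg b.
Proof. by move=> a0; rewrite /eneg -muleN; exact: eposM. Qed.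

(** The integration variable overwrites whatever was stored at coordinate [j]. *)
Lemma intC_indep S j (f : p.-tuple R -> \bar R) t : j \in S ->
  forall x, intC S f (setc x j t) = intC S f x.
Proof.
have setc_setc (x : p.-tuple R) s : setc (setc x j t) j s = setc x j s.
  by apply: eq_from_tnth => k; rewrite !tnth_mktuple; case: eqP.
elim: S => [//|i S IH]; rewrite inE => jiS x /=.
apply: eq_integral => s _.
have [<-|ji] := eqVneq j i; first by rewrite setc_setc.
by rewrite setcC// IH//; move: jiS; rewrite (negbTE ji).
Qed.

End JointIntegral.

(** * Measurability of inversion and of the extended logarithm *)

Section InverseMeasurable.
Context {R : realType} d {T : measurableType d}.

Lemma measurable_funV (f : T -> R) : measurable_fun setT f ->
  measurable_fun setT (fun x => (f x)^-1).
Proof.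
have mV : measurable_fun setT (fun r : R => r^-1).
  (* Inversion is written piecewise through [expR] and [ln], with the default value [0^-1 = 0]. *)
  apply: (eq_measurable_fun (fun r : R => if 0 < r then expR (- ln r)
      else if r < 0 then - expR (- ln (- r)) else 0)).
    move=> r _; have [r0|r0|<-] := ltgtP 0 r.
    - by rewrite expRN lnK.
    - by rewrite expRN lnK ?posrE ?oppr_gt0// invrN opprK.
    - by rewrite invr0.
  have mln : measurable_fun setT (@ln R) by exact: measurable_ln.
  apply: measurable_fun_ifT.
  - by apply: measurable_fun_ltr => //; exact: measurable_cst.
  - by apply: measurableT_comp => //; exact: measurable_funN.
  - apply: measurable_fun_ifT.
    + by apply: measurable_fun_ltr => //; exact: measurable_cst.
    + apply: measurable_funN; apply: measurableT_comp => //.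
      apply: measurable_funN.
      exact: (measurableT_comp mln (measurable_funN (@measurable_id _ R setT))).
    + exact: measurable_cst.
by move=> mf; exact: (measurableT_comp mV mf).
Qed.

Lemma measurable_elog (f : T -> R) : measurable_fun setT f ->
  measurable_fun setT (fun x => elog (f x)).
Proof.
have ml : measurable_fun setT (@elog R).
  apply: measurable_fun_ifT.
  - by apply: measurable_fun_ltr => //; exact: measurable_cst.
  - by apply/measurable_EFinP; exact: measurable_ln.
  - exact: measurable_cst.
by move=> mf; exact: (measurableT_comp ml mf).
Qed.

End InverseMeasurable.

(** * Margins, conditionals and the law of one observation *)

Section Population.
Context {R : realType} {p E : nat} {dens : 'I_E -> p.-tuple R -> R -> R}.
Hypothesis densP : forall e, joint_density (dens e).
Local Open Scope ereal_scope.
Implicit Types (e : 'I_E) (z : zset p) (h : p.-tuple R * R -> \bar R).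

Definition onz z := [seq j <- enum 'I_p | z j].

(** Dependence on [x^z] alone, stated one coordinate at a time because that is how [intCZr] consumes
    it. *)
Definition z_local {T : Type} z (f : p.-tuple R -> T) : Prop :=
  forall x j t, ~~ z j -> f (setc x j t) = f x.

Let D e (u : p.-tuple R * R) : \bar R := (dens e u.1 u.2)%:E.

Let D_ge0 e u : 0 <= D e u.
Proof. by rewrite lee_fin; case: (densP e). Qed.

Let measurable_D e : measurable_fun setT (D e).
Proof. by apply/measurable_EFinP; case: (densP e). Qed.

Lemma mem_offz z j : (j \in offz z) = ~~ z j.
Proof. by rewrite mem_filter mem_enum andbT. Qed.

Lemma margz_ge0 e z x y : 0 <= margz dens e z x y.
Proof. by apply: intC_ge0 => x'; exact: (D_ge0 e (x', y)). Qed.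

Lemma measurable_margz e z :
  measurable_fun setT (fun u : p.-tuple R * R => margz dens e z u.1 u.2).
Proof.
exact: (measurable_intC_param (offz z) _ _ (D e) (measurable_D e) (D_ge0 e)).
Qed.

Lemma margz_local e z y : z_local z (fun x => margz dens e z x y).
Proof. by move=> x j t zj; rewrite /margz intC_indep// mem_offz. Qed.

Lemma pxz_ge0 e z x : 0 <= pxz dens e z x.
Proof. by apply: integral_ge0 => y _; exact: margz_ge0. Qed.

Lemma measurable_pxz e z : measurable_fun setT (pxz dens e z).
Proof.
apply: (measurable_int_y (fun u => margz dens e z u.1 u.2)).
  exact: measurable_margz.
by move=> u; exact: margz_ge0.
Qed.

Lemma pxz_local e z : z_local z (pxz dens e z).
Proof. by move=> x j t zj; apply: eq_integral => y _; exact: margz_local. Qed.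

Lemma px_ge0 e x : 0 <= px dens e x.
Proof. by apply: integral_ge0 => y _; exact: (D_ge0 e (x, y)). Qed.

Lemma measurable_px e : measurable_fun setT (px dens e).
Proof. exact: (measurable_int_y (D e)). Qed.

Lemma measurable_pcond e z :
  measurable_fun setT (fun u : p.-tuple R * R => pcond dens e z u.1 u.2).
Proof.
apply: measurable_funM; first exact: measurableT_comp (measurable_margz e z).
apply: measurable_funV; apply: measurableT_comp => //.
exact: (measurableT_comp (measurable_pxz e z)).
Qed.

Lemma measurable_gpool z :
  measurable_fun setT (fun u : p.-tuple R * R => gpool dens z u.1 u.2).
Proof.
apply: measurable_funM.
  apply: measurableT_comp => //; apply: emeasurable_sum => e.
  exact: measurable_margz.
apply: measurable_funV; apply: measurableT_comp => //.
apply: emeasurable_sum => e.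
exact: (measurableT_comp (measurable_pxz e z)).
Qed.

Lemma pcond_ge0 e z x y : (0 <= pcond dens e z x y)%R.
Proof.
by apply: divr_ge0; apply: fine_ge0; [exact: margz_ge0|exact: pxz_ge0].
Qed.

Lemma gpool_ge0 z x y : (0 <= gpool dens z x y)%R.
Proof.
apply: divr_ge0; apply: fine_ge0; apply: sume_ge0 => e _; [exact: margz_ge0|].
exact: pxz_ge0.
Qed.

Lemma pcond_local e z y : z_local z (fun x => pcond dens e z x y).
Proof. by move=> x j t zj; rewrite /pcond margz_local// pxz_local. Qed.

Lemma gpool_local z y : z_local z (fun x => gpool dens z x y).
Proof.
move=> x j t zj; rewrite /gpool; congr (fine _ / fine _)%R.
  by apply: eq_bigr => e _; exact: margz_local.
by apply: eq_bigr => e _; exact: pxz_local.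
Qed.

(** When [fine] or the division returns a junk value, [pcond] is [0] and both
    sides vanish. *)
Lemma pxz_pcond e z x y :
  pxz dens e z x * (pcond dens e z x y)%:E =
  margz dens e z x y * ((pcond dens e z x y != 0)%:R)%:E.
Proof.
have [->|] := eqVneq (pcond dens e z x y) 0%R; first by rewrite /= !mule0.
rewrite mulf_eq0 negb_or invr_eq0 mule1 => /andP[].
rewrite /pcond; case: (margz dens e z x y) => [m| |]; rewrite ?eqxx// => m0.
case: (pxz dens e z x) => [q| |]; rewrite /= ?eqxx// => q0.
by rewrite -EFinM mulrCA divff// mulr1.
Qed.

(** Integrating the coordinates off [z] first, [A] factors out and Fubini turns what remains of [px]
    into the margin [pxz]. *)
Lemma intX_local e z (A : p.-tuple R -> \bar R) : measurable_fun setT A ->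
  (forall x, 0 <= A x) -> z_local z A ->
  intX (fun x => px dens e x * A x) =
  intC (onz z) (fun x => pxz dens e z x * A x) (x0 R p).
Proof.
move=> mA A0 Az.
rewrite /intX (intC_filter z) ?enum_uniq//; last 2 first.
- by apply: emeasurable_funM => //; exact: measurable_px.
- by move=> x; rewrite mule_ge0// px_ge0.
apply: eq_intC => x; rewrite intCZr//; last 3 first.
- exact: measurable_px.
- exact: px_ge0.
- by move=> y j t; rewrite mem_offz; exact: Az.
by congr (_ * _); rewrite -(intC_fubini _ (D e)).
Qed.

Lemma intXY_local e z h : measurable_fun setT h -> (forall u, 0 <= h u) ->
  (forall y, z_local z (fun x => h (x, y))) ->
  intXY (fun x y => (dens e x y)%:E * h (x, y)) =
  intC (onz z)
    (fun x => \int[@lebR R]_y (margz dens e z x y * h (x, y))) (x0 R p).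
Proof.
move=> mh h0 hz.
have mDh : measurable_fun setT (fun u => D e u * h u).
  exact: emeasurable_funM.
have Dh0 u : 0 <= D e u * h u by rewrite mule_ge0.
rewrite /intXY /intX (intC_filter z) ?enum_uniq//; last 2 first.
- exact: (measurable_int_y _ mDh).
- by move=> x; apply: integral_ge0 => y _; exact: (Dh0 (x, y)).
apply: eq_intC => x; rewrite -(intC_fubini _ (fun u => D e u * h u))//.
apply: eq_integral => y _.
rewrite (intCZr _ (fun x' => D e (x', y)) (fun x' => h (x', y)))//.
- exact: (measurable_fun_pair1 (f := D e)).
- by move=> x' j t; rewrite mem_offz; exact: hz.
Qed.

Context {nu : 'I_E -> {measure set (p.-tuple R * R) -> \bar R}}.
Hypothesis nuP : forall e A, measurable A ->
  nu e A = intXY (fun x y => (dens e x y)%:E * (((x, y) \in A)%:R)%:E).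

(** Integrability and almost-everywhere arguments become available once iterated integrals are
    integrals against the law [nu e]. *)
Lemma intXY_dens e h : measurable_fun setT h -> (forall u, 0 <= h u) ->
  intXY (fun x y => (dens e x y)%:E * h (x, y)) = \int[nu e]_u h u.
Proof.
move: h; apply: functional_integral.
- by move=> A mA; rewrite nuP.
- move=> f g mf mg f0 g0.
  rewrite -(intXYD (fun u => D e u * f u) (fun u => D e u * g u)).
  + by congr intXY; apply/funext => x; apply/funext => y; rewrite ge0_muleDr.
  + exact: emeasurable_funM.
  + exact: emeasurable_funM.
  + by move=> u; rewrite mule_ge0.
  + by move=> u; rewrite mule_ge0.
- move=> c f c0 mf f0; rewrite -(intXYZ _ (fun u => D e u * f u))//.
  + by congr intXY; apply/funext => x; apply/funext => y; rewrite muleCA.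
  + exact: emeasurable_funM.
  + by move=> u; rewrite mule_ge0.
- move=> g mg g0 ndg; rewrite -(intXY_lim (fun n u => D e u * g n u)).
  + congr intXY; apply/funext => x; apply/funext => y.
    apply/esym/cvg_lim => //; apply: cvgeZl => //.
    exact: ereal_nondecreasing_is_cvgn.
  + by move=> n; exact: emeasurable_funM.
  + by move=> n u; rewrite mule_ge0.
  + by move=> u m n mn; rewrite lee_wpmul2l//; exact: ndg.
Qed.

Lemma sintXY_dens e h : measurable_fun setT h ->
  sintXY (fun x y => (dens e x y)%:E * h (x, y)) = \int[nu e]_u h u.
Proof.
move=> mh; rewrite integralE /sintXY -!intXY_dens//.
- congr (_ - _); congr intXY; apply/funext => x; apply/funext => y.
    by rewrite eposM ?funeposE//; exact: (D_ge0 e (x, y)).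
  by rewrite enegM ?funenegE//; exact: (D_ge0 e (x, y)).
- exact: measurable_funeneg.
- exact: measurable_funepos.
Qed.

Lemma nu_setT e : nu e setT = 1.
Proof.
rewrite nuP//; have [_ _ <-] := densP e; congr intXY.
by apply/funext => x; apply/funext => y; rewrite in_setT mule1.
Qed.

(** A finite difference of extended reals has two finite terms, here the integrals of the positive
    and negative parts. *)
Lemma fin_integrable e h : measurable_fun setT h ->
  \int[nu e]_u h u \is a fin_num -> (nu e).-integrable setT h.
Proof.
move=> mh; rewrite integralE fin_numB => /andP[fp fn].
apply/integrableP; split=> //.
under eq_integral do rewrite -[`|_|]/((abse \o h) _) fune_abse.
rewrite ge0_integralD//.
- by rewrite lte_add_pinfty// ltey_eq ?fp ?fn.
- exact: measurable_funepos.
- exact: measurable_funeneg.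
Qed.

Lemma mixE_int (F : 'I_E -> p.-tuple R * R -> \bar R) :
  (forall e, measurable_fun setT (F e)) ->
  mixE dens (fun e x y => F e (x, y)) =
  (E%:R^-1)%:E * \sum_(e < E) \int[nu e]_u F e u.
Proof.
by move=> mF; congr (_ * _); apply: eq_bigr => e _; rewrite sintXY_dens.
Qed.

(** A finite sum of extended reals has only finite terms; the factor [1 / E] is positive since [e]
    itself shows [0 < E]. *)
Lemma mixE_fin (F : 'I_E -> p.-tuple R * R -> \bar R) :
  (forall e, measurable_fun setT (F e)) ->
  mixE dens (fun e x y => F e (x, y)) \is a fin_num ->
  forall e, (nu e).-integrable setT (F e).
Proof.
move=> mF; rewrite mixE_int// => fE e; apply: fin_integrable => //.
have E0 : (0 < E%:R^-1 :> R)%R.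
  by rewrite invr_gt0 ltr0n (leq_ltn_trans _ (ltn_ord e)).
have : \sum_(e < E) \int[nu e]_u F e u \is a fin_num.
  move: fE; case: (\sum_(e < E) _) => [//| |].
    by rewrite gt0_muley// lte_fin.
  by rewrite gt0_muleNy// lte_fin.
by move=> /sum_fin_numP; apply=> //; rewrite mem_index_enum.
Qed.

(** This also holds at [a = b = +oo], where [a - b = -oo]. *)
Lemma epos_subD (a b : \bar R) : 0 <= a -> 0 <= b ->
  epos (a - b) + b = eneg (a - b) + a.
Proof.
rewrite /epos /eneg; move: a b => [a| |] [b| |]//= a0 b0.
- have [ab|/ltW ba] := leP 0 (a%:E - b%:E).
    by rewrite max_r ?subeK// ?add0r// lee_fin oppr_le0.
  rewrite max_l; last by rewrite lee_fin oppr_ge0.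
  by rewrite add0r -EFinD opprB subrK.
- by rewrite addeNy maxNye add0r max_l ?leey.
- by rewrite addye// maxNye.
- by rewrite addeNy maxNye add0r max_l ?leey.
Qed.

Lemma epos_sub_le (a b : \bar R) : 0 <= a -> 0 <= b -> epos (a - b) <= a.
Proof.
by move=> a0 b0; rewrite /epos ge_max a0 andbT -[leRHS]adde0 leeD2l// oppe_le0.
Qed.

Lemma eneg_sub_le (a b : \bar R) : 0 <= a -> 0 <= b -> eneg (a - b) <= b.
Proof.
rewrite /eneg ge_max => a0 b0; rewrite b0 andbT; move: a0 b0.
case: a => [a| |]//; case: b => [b| |]//= a0 b0.
by rewrite lee_fin opprB gerBl.
all: by rewrite ?leey ?leNye.
Qed.

(** * The averaged KL divergence as the mean log-ratio *)

Section KullbackLeibler.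
Variables (e : 'I_E) (z : zset p).
Hypothesis pcond_gt0 : \forall u \ae nu e, (0 < pcond dens e z u.1 u.2)%R.

(** The chain rule [p(x^z) p(y | x^z) = p(x^z, y)] under the integral. *)
Lemma intX_pcond h : measurable_fun setT h -> (forall u, 0 <= h u) ->
  (forall y, z_local z (fun x => h (x, y))) ->
  intX (fun x => px dens e x *
    \int[@lebR R]_y ((pcond dens e z x y)%:E * h (x, y))) = \int[nu e]_u h u.
Proof.
move=> mh h0 hz.
pose k u := (pcond dens e z u.1 u.2)%:E * h u.
have mk : measurable_fun setT k.
  apply: emeasurable_funM => //; apply/measurable_EFinP.
  exact: measurable_pcond.
have k0 u : 0 <= k u by rewrite mule_ge0// lee_fin pcond_ge0.
(* The chain rule [pxz_pcond] carries an indicator of [pcond != 0]; it equals one almost everywhere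
   by [pcond_gt0]. *)
pose k' u := ((pcond dens e z u.1 u.2 != 0)%:R)%:E * h u.
have mk' : measurable_fun setT k'.
  apply: emeasurable_funM => //; apply/measurable_EFinP.
  apply: (eq_measurable_fun
    (fun u => if (0 < pcond dens e z u.1 u.2)%R then 1%R else 0%R : R)).
    by move=> u _; rewrite lt0r pcond_ge0 andbT; case: eqP.
  apply: measurable_fun_ifT; [|exact: measurable_cst..].
  by apply: measurable_fun_ltr; [exact: measurable_cst|exact: measurable_pcond].
have k'0 u : 0 <= k' u by rewrite mule_ge0// lee_fin.
rewrite (intX_local e z (fun x => \int[@lebR R]_y k (x, y))); last 3 first.
- exact: measurable_int_y.
- by move=> x; exact: integral_ge0.
- move=> x j t zj; apply: eq_integral => y _.
  by rewrite /k /= pcond_local// hz.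
transitivity (\int[nu e]_u k' u).
  rewrite -intXY_dens// (intXY_local e z)//; last first.
    by move=> y x j t zj; rewrite /k' /= pcond_local// hz.
  apply: eq_intC => x.
  rewrite -ge0_integralZl ?pxz_ge0//; last exact: (measurable_slice k).
  by apply: eq_integral => y _; rewrite /k /k' !muleA/= pxz_pcond.
apply: ae_eq_integral => //; apply: filterS pcond_gt0 => u u0 _.
by rewrite /k' gt_eqF// mul1e.
Qed.

Let r u : \bar R := elog (pcond dens e z u.1 u.2) - elog (gpool dens z u.1 u.2).

(** The left side splits by the sign of [KL], after integration over [y]; the right side splits by
    the sign of [r], before it. The two splittings are balanced in an additive identity, and
    finiteness then allows subtraction. *)
Lemma sintX_KL : \int[nu e]_u r^\+ u < +oo -> \int[nu e]_u r^\- u < +oo ->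
  sintX (fun x => px dens e x * KL dens e z x) = \int[nu e]_u r u.
Proof.
move=> rp rn.
have mr : measurable_fun setT r.
  apply: emeasurable_funB; apply: measurable_elog.
    exact: measurable_pcond.
  exact: measurable_gpool.
have rz y : z_local z (fun x => r (x, y)).
  by move=> x j t zj; rewrite /r /= pcond_local// gpool_local.
have mpc : measurable_fun setT (fun u => (pcond dens e z u.1 u.2)%:E).
  by apply/measurable_EFinP; exact: measurable_pcond.
pose W h x := \int[@lebR R]_y ((pcond dens e z x y)%:E * h (x, y)).
have W0 h : (forall u, 0 <= h u) -> forall x, 0 <= W h x.
  move=> h0 x; apply: integral_ge0 => y _.
  by rewrite mule_ge0// lee_fin pcond_ge0.
have mW h : measurable_fun setT h -> (forall u, 0 <= h u) ->
    measurable_fun setT (W h).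
  move=> mh h0.
  apply: (measurable_int_y (fun u => (pcond dens e z u.1 u.2)%:E * h u)).
    exact: emeasurable_funM.
  by move=> u; rewrite mule_ge0// lee_fin pcond_ge0.
have KLE x : KL dens e z x = W r^\+ x - W r^\- x.
  rewrite /KL integralE; congr (_ - _); apply: eq_integral => y _.
    by rewrite !funeposE -[LHS]/(epos _) eposM// lee_fin pcond_ge0.
  by rewrite !funenegE -[LHS]/(eneg _) enegM// lee_fin pcond_ge0.
have mrp := measurable_funepos mr; have mrn := measurable_funeneg mr.
have A0 := W0 _ (funepos_ge0 r); have B0 := W0 _ (funeneg_ge0 r).
have mA := mW _ mrp (funepos_ge0 r); have mB := mW _ mrn (funeneg_ge0 r).
have mK : measurable_fun setT (KL dens e z).
  rewrite (_ : KL dens e z = fun x => W r^\+ x - W r^\- x); last exact/funext.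
  exact: emeasurable_funB.
have mKp : measurable_fun setT (fun x => px dens e x * epos (KL dens e z x)).
  apply: emeasurable_funM; first exact: measurable_px.
  by apply: measurable_maxe => //; exact: measurable_cst.
have mKn : measurable_fun setT (fun x => px dens e x * eneg (KL dens e z x)).
  apply: emeasurable_funM; first exact: measurable_px.
  apply: measurable_maxe; last exact: measurable_cst.
  exact: measurableT_comp.
have mpxM (k : p.-tuple R -> \bar R) : measurable_fun setT k ->
    measurable_fun setT (fun x => px dens e x * k x).
  by move=> mk; apply: emeasurable_funM => //; exact: measurable_px.
have pxM0 x (a : \bar R) : 0 <= a -> 0 <= px dens e x * a.
  by move=> a0; rewrite mule_ge0// px_ge0.
have WE h : measurable_fun setT h -> (forall u, 0 <= h u) ->
    (forall y, z_local z (fun x => h (x, y))) ->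
    intX (fun x => px dens e x * W h x) = \int[nu e]_u h u.
  exact: intX_pcond.
have WpE : intX (fun x => px dens e x * W r^\+ x) = \int[nu e]_u r^\+ u.
  apply: WE => //.
  by move=> y x j t zj; rewrite !funeposE rz.
have WnE : intX (fun x => px dens e x * W r^\- x) = \int[nu e]_u r^\- u.
  apply: WE => //.
  by move=> y x j t zj; rewrite !funenegE rz.
rewrite /sintX; pose U := intX (fun x => px dens e x * epos (KL dens e z x)).
pose V := intX (fun x => px dens e x * eneg (KL dens e z x)).
have -> : intX (fun x => epos (px dens e x * KL dens e z x)) = U.
  by apply: eq_intC => x; rewrite eposM// px_ge0.
have -> : intX (fun x => eneg (px dens e x * KL dens e z x)) = V.
  by apply: eq_intC => x; rewrite enegM// px_ge0.
have U0 : 0 <= U by apply: intC_ge0 => x; apply: pxM0; exact: epos_ge0.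
have V0 : 0 <= V by apply: intC_ge0 => x; apply: pxM0; exact: eneg_ge0.
have UA : U <= \int[nu e]_u r^\+ u.
  rewrite -WpE; apply: le_intC => //.
  - exact: mpxM.
  - by move=> x; apply: pxM0; exact: epos_ge0.
  - by move=> x; rewrite lee_wpmul2l ?px_ge0// KLE epos_sub_le.
have VB : V <= \int[nu e]_u r^\- u.
  rewrite -WnE; apply: le_intC => //.
  - exact: mpxM.
  - by move=> x; apply: pxM0; exact: eneg_ge0.
  - by move=> x; rewrite lee_wpmul2l ?px_ge0// KLE eneg_sub_le.
(* This is [epos_subD] at [W r^\+ x] and [W r^\- x], weighted by [px] and integrated; it covers the
   points where [KL] is [+oo - +oo]. *)
have UVE : U + \int[nu e]_u r^\- u = V + \int[nu e]_u r^\+ u.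
  rewrite -WnE -WpE -!intCD//; try by [exact: mpxM|move=> x; apply: pxM0 => //
    ; solve [exact: epos_ge0|exact: eneg_ge0]].
  apply: eq_intC => x.
  by rewrite -!ge0_muleDr ?epos_ge0 ?eneg_ge0// KLE epos_subD.
rewrite integralE; move: U0 V0 UA VB UVE rp rn.
have rp0 : 0 <= \int[nu e]_u r^\+ u.
  by apply: integral_ge0 => u _; exact: funepos_ge0.
have rn0 : 0 <= \int[nu e]_u r^\- u.
  by apply: integral_ge0 => u _; exact: funeneg_ge0.
move: rp0 rn0.
case: (\int[nu e]_u r^\+ u) => [a| |]//.
case: (\int[nu e]_u r^\- u) => [b| |]//.
case: U => [u| |]//; case: V => [v| |]// _ _ _ _ _ _ [uv] _ _.
by congr EFin; lra.
Qed.

End KullbackLeibler.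
End Population.

(** * Comparison of the population means of the two log-likelihoods *)

Lemma ae_le_integral (R : realType) d (T : measurableType d)
    (mu : {measure set T -> \bar R}) (f g : T -> \bar R) :
  measurable_fun setT f -> measurable_fun setT g ->
  (\forall x \ae mu, (f x <= g x)%E) ->
  (\int[mu]_x f x <= \int[mu]_x g x)%E.
Proof.
move=> mf mg fg; rewrite integralE [leRHS]integralE; apply: leeB.
- apply: ae_ge0_le_integral => //.
  + exact: measurable_funepos.
  + exact: measurable_funepos.
  + apply: filterS fg => x fgx _; rewrite !funeposE.
    by rewrite ge_max !le_max fgx lexx orbT.
- apply: ae_ge0_le_integral => //.
  + exact: measurable_funeneg.
  + exact: measurable_funeneg.
  + apply: filterS fg => x fgx _; rewrite !funenegE.
    by rewrite ge_max !le_max leeN2 fgx lexx orbT.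
Qed.

Section LossComparison.
Context {R : realType} {p E : nat} {dens : 'I_E -> p.-tuple R -> R -> R}.
Hypothesis densP : forall e, joint_density (dens e).
Context {nu : 'I_E -> {measure set (p.-tuple R * R) -> \bar R}}.
Hypothesis nuP : forall e A, measurable A ->
  nu e A = intXY (fun x y => (dens e x y)%:E * (((x, y) \in A)%:R)%:E)%E.
Local Open Scope ereal_scope.
Variable z : zset p.

Let lp e (u : p.-tuple R * R) := elog (pcond dens e z u.1 u.2).
Let lg (u : p.-tuple R * R) := elog (gpool dens z u.1 u.2).

Hypothesis lp_fin :
  mixE dens (fun e x y => elog (pcond dens e z x y)) \is a fin_num.
Hypothesis lg_fin :
  mixE dens (fun e x y => elog (gpool dens z x y)) \is a fin_num.

Let mlp e : measurable_fun setT (lp e).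
Proof. by apply: measurable_elog; exact: measurable_pcond. Qed.

Let mlg : measurable_fun setT lg.
Proof. by apply: measurable_elog; exact: measurable_gpool. Qed.

Let ilp e : (nu e).-integrable setT (lp e).
Proof. exact: (mixE_fin densP nuP lp mlp lp_fin e). Qed.

Let ilg e : (nu e).-integrable setT lg.
Proof. exact: (mixE_fin densP nuP (fun=> lg) (fun=> mlg) lg_fin e). Qed.

(** An integrable function is finite almost everywhere, and [elog] is [-oo] at every argument that
    is not positive. *)
Let pc_gt0 e : \forall u \ae nu e, (0 < pcond dens e z u.1 u.2)%R.
Proof.
apply: filterS (integrable_ae measurableT (ilp e)) => u /(_ I).
by rewrite /lp /elog; case: ifP.
Qed.

Let g_gt0 e : \forall u \ae nu e, (0 < gpool dens z u.1 u.2)%R.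
Proof.
apply: filterS (integrable_ae measurableT (ilg e)) => u /(_ I).
by rewrite /lg /elog; case: ifP.
Qed.

Lemma muz_mixE : muz dens z =
  mixE dens (fun e x y => elog (pcond dens e z x y)) -
  mixE dens (fun e x y => elog (gpool dens z x y)).
Proof.
rewrite (mixE_int densP nuP lp)// (mixE_int densP nuP (fun=> lg))// /muz.
have fp e := integrable_fin_num measurableT (ilp e).
have fg e := integrable_fin_num measurableT (ilg e).
rewrite -muleBr//; last first.
  rewrite fin_num_adde_defl// ?fin_numN; apply/sum_fin_numP => e _ _; exact: fg.
congr (_ * _).
transitivity (\sum_(e < E) (\int[nu e]_u lp e u - \int[nu e]_u lg u)).
  apply: eq_bigr => e _; rewrite -integralB//.
  have ir := integrableB measurableT (ilp e) (ilg e).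
  rewrite (sintX_KL densP nuP)//.
  - exact: integral_funepos_lt_pinfty ir.
  - exact: integral_funeneg_lt_pinfty ir.
pose ip e := fine (\int[nu e]_u lp e u).
pose ig e := fine (\int[nu e]_u lg u).
rewrite (eq_bigr (fun e => (ip e - ig e)%:E)).
  rewrite [X in _ = X - _](eq_bigr (fun e => (ip e)%:E)) => [|e _]; last first.
    by rewrite (fineK (fp e)).
  rewrite [X in _ = _ - X](eq_bigr (fun e => (ig e)%:E)) => [|e _]; last first.
    by rewrite (fineK (fg e)).
  by rewrite !sumEFin sumrB.
by move=> e _; rewrite EFinB (fineK (fp e)) (fineK (fg e)).
Qed.

(** Since [g] is the pooled joint margin over the pooled feature margin, weighting the joint margin
    by [q / g] leaves at most the feature margin times [q]. Integrating [q] over [y] gives one, and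
    the pooled feature margin has mass [E]. *)
Lemma sum_int_ratio_le (q : p.-tuple R -> R -> R) : cond_density z q ->
  \sum_(e < E) \int[nu e]_u (q u.1 u.2 / gpool dens z u.1 u.2)%:E <= E%:R%:E.
Proof.
move=> [qz q0 mq q1].
pose h (u : p.-tuple R * R) : \bar R := (q u.1 u.2 / gpool dens z u.1 u.2)%:E.
have h0 u : 0 <= h u by rewrite lee_fin divr_ge0// gpool_ge0.
have mh : measurable_fun setT h.
  apply/measurable_EFinP; apply: measurable_funM => //.
  by apply: measurable_funV; exact: measurable_gpool.
have qloc y : z_local z (fun x => q x y).
  move=> x j t zj; rewrite (qz (setc x j t) x)// => i zi.
  by rewrite tnth_mktuple; case: eqP => // ij; move: zj; rewrite -ij zi.
have hz y : z_local z (fun x => h (x, y)).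
  by move=> x j t zj; rewrite /h /= qloc// gpool_local.
have mm e := measurable_margz densP e z.
have m0 e x y : 0 <= margz dens e z x y by exact: margz_ge0.
have mmh e : measurable_fun setT (fun u => margz dens e z u.1 u.2 * h u).
  exact: emeasurable_funM.
have mh0 e x y : 0 <= margz dens e z x y * h (x, y) by rewrite mule_ge0.
rewrite (eq_bigr (fun e => intC (onz z)
  (fun x => \int[@lebR R]_y (margz dens e z x y * h (x, y))) (x0 R p)));
  last first.
  by move=> e _; rewrite -(intXY_dens densP nuP _ h)// (intXY_local densP e z).
rewrite -intC_sum; last 2 first.
- move=> e.
  by apply: (measurable_int_y (fun u => margz dens e z u.1 u.2 * h u)).
- by move=> e x; exact: integral_ge0.
have -> : E%:R%:E =
    intC (onz z) (fun x => \sum_(e < E) pxz dens e z x) (x0 R p).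
  rewrite intC_sum; last 2 first.
  - by move=> e; exact: measurable_pxz.
  - by move=> e x; exact: pxz_ge0.
  rewrite (eq_bigr (fun=> 1%:E)).
    by rewrite sumEFin sumr_const card_ord.
  move=> e _; have [_ _ <-] := densP e.
  have := intX_local densP e z (fun=> 1) (measurable_cst _) (fun=> lee01)
    (fun=> fun=> fun=> fun=> erefl).
  rewrite (eq_intC _ _ (pxz dens e z)) => [<-|x]; last by rewrite mule1.
  by apply: eq_intC => x; rewrite mule1.
apply: le_intC.
- apply: emeasurable_sum => e.
  by apply: (measurable_int_y (fun u => margz dens e z u.1 u.2 * h u)).
- by apply: emeasurable_sum => e; exact: measurable_pxz.
- by move=> x; apply: sume_ge0 => e _; exact: integral_ge0.
move=> x; rewrite -ge0_integral_sum//; last first.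
  move=> e.
  exact: (measurable_slice (fun u => margz dens e z u.1 u.2 * h u)).
have S0 : 0 <= \sum_(e < E) pxz dens e z x.
  by apply: sume_ge0 => e _; exact: pxz_ge0.
(* The factor one is inserted as the integral of [q] over [y], so that the integrands can be
   compared pointwise. *)
have -> : \sum_(e < E) pxz dens e z x =
    \int[@lebR R]_y ((\sum_(e < E) pxz dens e z x) * (q x y)%:E).
  rewrite ge0_integralZl ?q1 ?mule1//.
  - apply/measurable_EFinP.
    exact: (measurable_fun_pair2 (f := fun u => q u.1 u.2)).
  - by move=> y _; rewrite lee_fin.
apply: ge0_le_integral => //.
- by move=> y _; apply: sume_ge0 => e _.
- apply: emeasurable_sum => e.
  exact: (measurable_slice (fun u => margz dens e z u.1 u.2 * h u)).
- apply: measurable_funeM; apply/measurable_EFinP.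
  exact: (measurable_fun_pair2 (f := fun u => q u.1 u.2)).
(* Pointwise [(sum margz) * (q / g) <= (sum pxz) * q]: equality holds when both
   sums are finite and nonzero, and otherwise [g = 0] makes [q / g] zero. *)
move=> y _; rewrite -ge0_sume_distrl// /h /= /gpool.
have : 0 <= \sum_(e < E) margz dens e z x y by apply: sume_ge0.
case: (\sum_(e < E) margz dens e z x y) => [m| |]//= m_ge0; last first.
  by rewrite mul0r invr0 mulr0 mule0 mule_ge0// lee_fin.
case: (\sum_(e < E) pxz dens e z x) S0 => [s| |]//= s0; last first.
  by rewrite invr0 mulr0 invr0 mulr0 mule0 mule_ge0// lee_fin.
rewrite -!EFinM lee_fin invf_div.
have [->|m_neq0] := eqVneq m 0%R; first by rewrite mul0r mulr_ge0.
by rewrite mulrCA mulrC [(m * _)%R]mulrCA divff// mulr1.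
Qed.

Lemma invariant_mixE_le : env_invariant dens z ->
  mixE dens (fun e x y => elog (pcond dens e z x y)) <=
  mixE dens (fun e x y => elog (gpool dens z x y)).
Proof.
move=> [q [qcond pq]]; have [_ q0 mq _] := qcond.
rewrite (mixE_int densP nuP lp)// (mixE_int densP nuP (fun=> lg))//.
rewrite lee_wpmul2l ?lee_fin ?invr_ge0//.
have fp e := integrable_fin_num measurableT (ilp e).
have fg e := integrable_fin_num measurableT (ilg e).
pose h (u : p.-tuple R * R) : \bar R := (q u.1 u.2 / gpool dens z u.1 u.2)%:E.
have h0 u : 0 <= h u by rewrite lee_fin divr_ge0// gpool_ge0.
have mh : measurable_fun setT h.
  apply/measurable_EFinP; apply: measurable_funM => //.
  by apply: measurable_funV; exact: measurable_gpool.
have hE := sum_int_ratio_le q qcond; rewrite -/h in hE.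
(* Invariance says that the indicator of [pcond != q] has zero integral, hence vanishes almost
   everywhere. *)
have pqae e : \forall u \ae nu e, pcond dens e z u.1 u.2 = q u.1 u.2.
  pose k (u : p.-tuple R * R) : \bar R :=
    ((pcond dens e z u.1 u.2 != q u.1 u.2)%:R)%:E.
  have mk : measurable_fun setT k.
    apply/measurable_EFinP; apply: (eq_measurable_fun
      (fun u => if pcond dens e z u.1 u.2 == q u.1 u.2 then 0%R else 1%R : R)).
      by move=> u _; case: eqP.
    apply: measurable_fun_ifT; [|exact: measurable_cst..].
    apply: measurable_fun_eqr; [exact: (measurable_pcond densP e z)|exact: mq].
  have k0 u : 0 <= k u by rewrite lee_fin.
  have /(ae_eq_integral_abs _ measurableT mk) : \int[nu e]_u `|k u| = 0.
    rewrite -(pq e) (intXY_dens densP nuP _ k)//; apply: eq_integral => u _.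
    by rewrite gee0_abs.
  apply: filterS => u /(_ I); rewrite /k; case: eqP => //= _ [] /eqP.
  by rewrite oner_eq0.
have hfin e : \int[nu e]_u h u < +oo.
  apply: le_lt_trans (ltry E%:R); apply: le_trans hE.
  rewrite (bigD1 e)//= leeDl//; apply: sume_ge0 => i _.
  by apply: integral_ge0 => u _; exact: h0.
have ih e : (nu e).-integrable setT h.
  apply/integrableP; split=> //; apply: le_lt_trans (hfin e).
  rewrite le_eqVlt; apply/orP; left; apply/eqP/eq_integral => u _.
  by rewrite gee0_abs.
have int1 e : \int[nu e]_u cst 1 u = 1.
  by rewrite integral_cst// mul1e (nu_setT densP nuP).
have i1 e : (nu e).-integrable setT (cst 1).
  apply/integrableP; split; first exact: measurable_cst.
  rewrite (eq_integral (cst 1)) ?int1 ?ltry// => u _.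
  by rewrite /= normr1.
(* This is [ln (q / g) <= q / g - 1] integrated, arranged without subtraction of extended reals.
   Summed over [e], the ones add up to [E] and cancel the bound on the integrals of [h]. *)
have key e : \int[nu e]_u lp e u + 1 <= \int[nu e]_u lg u + \int[nu e]_u h u.
  rewrite -(int1 e) -!integralD//; apply: ae_le_integral.
  - by apply: emeasurable_funD => //; exact: measurable_cst.
  - exact: emeasurable_funD.
  apply: filterS3 (pc_gt0 e) (g_gt0 e) (pqae e) => u + + pqu.
  rewrite /lp /lg /elog /h /= pqu => q_gt0 g0; rewrite q_gt0 g0 -!EFinD lee_fin.
  have := le_ln1Dx (x := q u.1 u.2 / gpool dens z u.1 u.2 - 1)%R.
  rewrite ltrBrDl subrr divr_gt0// => /(_ isT).
  by rewrite addrC subrK ln_div ?posrE//; lra.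
have : \sum_(e < E) (\int[nu e]_u lp e u + 1) <=
       \sum_(e < E) (\int[nu e]_u lg u + \int[nu e]_u h u).
  by apply: lee_sum => e _; exact: key.
rewrite [leLHS]big_split [leRHS]big_split => /le_trans/(_ (leeD2l _ hE)).
by rewrite sumEFin sumr_const card_ord leeD2rE.
Qed.

End LossComparison.

(** * Total variation distance of a normalised weight to a point mass *)

Section TotalVariation.
Context {R : realType} {T : finType}.
Variables (zs : T) (wt : T -> R).
Hypothesis wt_ge0 : forall z, 0 <= wt z.

(** The mass off [zs] appears twice, as itself and as the deficit at [zs], which cancels the factor
    one half. *)
Lemma tvd_posterior : 0 < \sum_z wt z ->
  tvd (fun z => wt z / \sum_z' wt z') (fun z => (z == zs)%:R) =
  (\sum_(z | z != zs) wt z) / \sum_z wt z.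
Proof.
move=> S0; rewrite /tvd (bigD1 zs)//= eqxx.
set U := \sum_(z | z != zs) wt z; set S := \sum_z wt z.
have SE : S = wt zs + U by rewrite /S (bigD1 zs).
have U0 : 0 <= U by exact: sumr_ge0.
have -> : \sum_(z | z != zs) `|wt z / S - (z == zs)%:R| = U / S.
  rewrite mulr_suml; apply: eq_bigr => z /negbTE ->.
  by rewrite subr0 ger0_norm// divr_ge0// ltW.
have -> : wt zs / S - 1%:R = - (U / S).
  have -> : wt zs = S - U by rewrite SE addrK.
  by rewrite mulrBl divff ?lt0r_neq0// addrC addKr.
rewrite normrN ger0_norm ?divr_ge0// ?ltW//.
by lra.
Qed.

Lemma tvd_posterior_le1 :
  tvd (fun z => wt z / \sum_z' wt z') (fun z => (z == zs)%:R) <= 1.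
Proof.
have : 0 <= \sum_z wt z by exact: sumr_ge0.
rewrite le_eqVlt => /predU1P[S0|S0].
  (* With zero total weight the quotient is zero everywhere by default, and the distance is one
     half. *)
  rewrite /tvd -S0 (bigD1 zs)//= big1 => [|z /negbTE ->]; last first.
    by rewrite invr0 mulr0 subr0 normr0.
  by rewrite invr0 mulr0 eqxx sub0r normrN normr1 addr0 mulr1 invf_le1 ?ler1n.
rewrite tvd_posterior// ler_pdivrMr// mul1r [leRHS](bigD1 zs)//=.
by rewrite lerDr.
Qed.

End TotalVariation.

(** Bounding the normaliser below by the weight of [zs] leaves the sum of the odds against [zs].
    Each odds on the support is a prior odds times [expR (a z - a zs)]. *)
Lemma tvd_posterior_le_exp (R : realType) (T : finType) (zs : T)
    (prior ratio a : T -> R) (c : R) :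
  (forall z, 0 <= prior z) -> 0 < prior zs -> (forall z, 0 <= ratio z) ->
  (forall z, 0 < prior z -> ratio z = expR (a z)) ->
  (forall z, z != zs -> 0 < prior z -> a z <= a zs - c) ->
  tvd (fun z => prior z * ratio z / \sum_z' prior z' * ratio z')
      (fun z => (z == zs)%:R) <=
  (\big[Num.max/0]_(z | z != zs) (prior z / prior zs)) *
    #|[pred z | 0 < prior z]|%:R * expR (- c).
Proof.
move=> prior0 priors ratio0 ratioE ac.
pose wt z := prior z * ratio z.
have wt0 z : 0 <= wt z by rewrite mulr_ge0.
have wts : 0 < wt zs by rewrite mulr_gt0// ratioE// expR_gt0.
have wtsS : wt zs <= \sum_z wt z by rewrite (bigD1 zs)//= lerDl sumr_ge0.
rewrite tvd_posterior//; last exact: lt_le_trans wtsS.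
apply: (@le_trans _ _ ((\sum_(z | z != zs) wt z) / wt zs)).
  apply: ler_wpM2l; first by apply: sumr_ge0 => z _; exact: wt0.
  by rewrite lef_pV2// posrE (lt_le_trans wts).
set M := \big[Num.max/0]_(z | z != zs) _.
have M0 : 0 <= M by exact: bigmax_ge_id.
rewrite mulr_suml (bigID (fun z => 0 < prior z))/=.
rewrite [X in _ + X]big1 ?addr0; last first.
  move=> z /andP[_]; rewrite lt0r prior0 andbT negbK => /eqP p0.
  by rewrite /wt p0 !mul0r.
(* Admitting the nonnegative term at [zs] makes the number of terms the full support size. *)
apply: (@le_trans _ _ (\sum_(z | 0 < prior z) M * expR (- c))); last first.
  rewrite sumr_const -[leLHS]mulr_natr mulrAC.
  by rewrite (eq_card (B := [pred z | 0 < prior z])).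
rewrite big_mkcondl; apply: ler_sum => z pz; case: ifP => [zzs|_]; last first.
  by rewrite mulr_ge0// expR_ge0.
rewrite /wt (ratioE _ pz) (ratioE _ priors) invfM mulrACA -expRB.
apply: ler_pM => //; rewrite ?divr_ge0// ?expR_ge0//.
  exact: le_bigmax_cond.
by rewrite ler_expR lerBlDr addrC ac.
Qed.

(** * Empirical means near their limits, and the exceptional events *)

(** The [x] are empirical means at a competitor with limits [lp], [lg]; the [y] are those at the
    invariant [z*] with limits [mp], [mg]. Four deviations cost at most [4 * eta], which the slack
    [m - c] absorbs. *)
Lemma gap_perturb (R : realFieldType) (xp xg lp lg yp yg mp mg m c eta : R) :
  `|xp - lp| < eta -> `|xg - lg| < eta -> `|yp - mp| < eta -> `|yg - mg| < eta ->
  m <= lp - lg -> mp <= mg -> 4 * eta <= m - c -> xg - xp <= yg - yp - c.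
Proof.
rewrite !ltr_distl => /andP[? _] /andP[_ ?] /andP[_ ?] /andP[? _] ? ? ?.
by lra.
Qed.

(** Finiteness excludes every summand [-oo], so all likelihood values are positive and [elog] is
    [ln] throughout. *)
Lemma elog_mean (R : realType) (I J : finType) (c : R) (a : I -> J -> R) :
  0 < c ->
  (c%:E * \sum_i \sum_j elog (a i j))%E \is a fin_num ->
  (forall i j, 0 < a i j) /\
  fine (c%:E * \sum_i \sum_j elog (a i j))%E = c * \sum_i \sum_j ln (a i j).
Proof.
move=> c0 cfin.
have : (\sum_i \sum_j elog (a i j))%E \is a fin_num.
  move: cfin; case: (\sum_i _)%E => [//| |].
    by rewrite gt0_muley// lte_fin.
  by rewrite gt0_muleNy// lte_fin.
move=> /sum_fin_numP sfin; have a0 i j : 0 < a i j.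
  have /sum_fin_numP/(_ j) := sfin i (mem_index_enum _) isT.
  by rewrite mem_index_enum /elog => /(_ isT isT); case: ifP.
split=> //; rewrite -[RHS]/(fine (c * _)%:E) EFinM; congr (fine (_ * _)).
rewrite -sumEFin; apply: eq_bigr => i _; rewrite -sumEFin.
by apply: eq_bigr => j _; rewrite /elog a0.
Qed.

Lemma measure_bigU_le (R : realType) d (T : measurableType d)
    (mu : {measure set T -> \bar R}) (I : Type) (s : seq I) (F : I -> set T) :
  (forall i, measurable (F i)) ->
  (mu (\big[setU/set0]_(i <- s) F i) <= \sum_(i <- s) mu (F i))%E.
Proof.
move=> mF; elim: s => [|i s IH]; first by rewrite !big_nil measure0.
rewrite !big_cons; apply: le_trans (leeD2l _ IH).
by apply: measureU2 => //; exact: bigsetU_measurable.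
Qed.

Section BadEvent.
Context {R : realType} {d} {Om : measurableType d}.

(** The event whose probability vanishes in [cvg_in_prob]; infinite values of [X] belong to it. *)
Definition bad_event (X : Om -> \bar R) (l eps : R) : set Om :=
  [set w | ~ (X w \is a fin_num /\ `|fine (X w) - l| < eps)].

Lemma measurable_bad_event X l eps : measurable_fun setT X ->
  measurable (bad_event X l eps).
Proof.
move=> mX.
(* Two strict bounds by real numbers already force [X w] to be finite. *)
have -> : bad_event X l eps =
    ~` ((setT `&` [set w | (l - eps)%:E < X w]%E) `&`
        (setT `&` [set w | X w < (l + eps)%:E]%E)).
  rewrite !setTI; apply/seteqP; split=> w /=; apply: contra_not.
    case: (X w) => [r| |] [] //=; rewrite !lte_fin => h1 h2.
    by split=> //; rewrite ltr_distl h1.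
  by case: (X w) => [r| |] [] //=; rewrite ltr_distl !lte_fin => _ /andP[].
apply: measurableC; apply: measurableI.
  exact: emeasurable_fun_o_infty.
exact: emeasurable_fun_infty_o.
Qed.

End BadEvent.

(** * Concentration of the estimated posterior at the invariant [z*] *)

Theorem theorem4 (R : realType) (p E : nat) (d : measure_display)
  (Om : measurableType d) (P : probability Om R)
  (dens : 'I_E -> p.-tuple R -> R -> R)
  (Obs : 'I_E -> nat -> Om -> p.-tuple R * R)
  (prior : zset p -> R)
  (Model : zset p -> set (p.-tuple R -> R -> R))
  (phat : nat -> 'I_E -> zset p -> Om -> p.-tuple R -> R -> R)
  (ghat : nat -> zset p -> Om -> p.-tuple R -> R -> R)
  (zs : zset p) (kappa : R) :
  (0 < E)%N ->
  (* environments and data *)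
  (forall e, joint_density (dens e)) ->
  (forall e i, measurable_fun setT (Obs e i)) ->
  (forall e i A, measurable A ->
     P (Obs e i @^-1` A) =
     intXY (fun x y => (dens e x y)%:E * (((x, y) \in A)%:R)%:E)%E) ->
  mutually_indep P (fun k : 'I_E * nat => Obs k.1 k.2) ->
  (* prior *)
  (forall z, 0 <= prior z) -> \sum_z prior z = 1 ->
  (* model classes and maximum-likelihood estimators *)
  (forall z q, Model z q -> cond_density z q) ->
  (forall n e z w, Model z (phat n e z w) /\
     forall q, Model z q ->
       (\sum_(i < n) elog (q (Obs e i w).1 (Obs e i w).2) <=
        \sum_(i < n) elog (phat n e z w (Obs e i w).1 (Obs e i w).2))%E) ->
  (forall n z w, Model z (ghat n z w) /\
     forall q, Model z q ->
       (\sum_(e < E) \sum_(i < n) elog (q (Obs e i w).1 (Obs e i w).2) <=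
        \sum_(e < E) \sum_(i < n) elog (ghat n z w (Obs e i w).1 (Obs e i w).2))%E) ->
  (forall n e z i, measurable_fun setT
     (fun w => phat n e z w (Obs e i w).1 (Obs e i w).2)) ->
  (forall n z e i, measurable_fun setT
     (fun w => ghat n z w (Obs e i w).1 (Obs e i w).2)) ->
  (* Invariance and Uniqueness *)
  env_invariant dens zs ->
  (forall z, env_invariant dens z -> z = zs) ->
  (* Prior positivity *)
  0 < prior zs ->
  (* Estimation consistency given fixed environments *)
  (forall z, 0 < prior z ->
     cvg_in_prob P
       (fun n w => (((n * E)%:R)^-1%:E *
          \sum_(i < n) \sum_(e < E) elog (phat n e z w (Obs e i w).1 (Obs e i w).2))%E)
       (mixE dens (fun e x y => elog (pcond dens e z x y))) /\
     cvg_in_prob P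
       (fun n w => (((n * E)%:R)^-1%:E *
          \sum_(i < n) \sum_(e < E) elog (ghat n z w (Obs e i w).1 (Obs e i w).2))%E)
       (mixE dens (fun e x y => elog (gpool dens z x y)))) ->
  (* Finite variance *)
  (forall z, 0 < prior z ->
     (mixVar dens (fun e x y => elog (pcond dens e z x y) - elog (gpool dens z x y))
        < +oo)%E) ->
  0 < kappa < 1 ->
  let post n w z :=
    let wt z' := prior z' * \prod_(e < E) \prod_(i < n)
        (ghat n z' w (Obs e i w).1 (Obs e i w).2 /
         phat n e z' w (Obs e i w).1 (Obs e i w).2) in
    wt z / \sum_z' wt z' in
  let Rc := (\big[Num.max/0]_(z | z != zs) (prior z / prior zs)) *
            #|[pred z : zset p | 0 < prior z]|%:R in
  let mumin := (\big[Order.min/+oo]_(z | (z != zs) && (0 < prior z)%R) muz dens z)%E in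
  exists eps : nat -> R,
    (exists C : R, \forall n \near \oo,
       ((`|eps n|)%:E <= (C * Rc)%:E * expeR (- ((kappa * n%:R * E%:R)%:E * mumin)))%E) /\
    P [set w | eps n < tvd (post n w) (fun z => (z == zs)%:R)] @[n --> \oo] --> 0%E.
Proof.
move=> HE densP mObs lawObs _ prior0 _ ModelP phatP ghatP mphat mghat.
move=> invar _ priors cons _ /andP[k0 k1] post Rc mumin.
pose ratio n w (z : zset p) := \prod_(e < E) \prod_(i < n)
  (ghat n z w (Obs e i w).1 (Obs e i w).2 /
   phat n e z w (Obs e i w).1 (Obs e i w).2).
have ratio0 n w z : 0 <= ratio n w z.
  apply: prodr_ge0 => e _; apply: prodr_ge0 => i _; apply: divr_ge0.
    have [/ModelP[_ g0 _ _] _] := ghatP n z w; exact: g0.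
  have [/ModelP[_ f0 _ _] _] := phatP n e z w; exact: f0.
have wt0 n w z : 0 <= prior z * ratio n w z by rewrite mulr_ge0.
have mratio n z : measurable_fun setT (fun w => ratio n w z).
  apply: measurable_prod => e _; apply: measurable_prod => i _.
  apply: measurable_funM; first exact: mghat.
  by apply: measurable_funV; exact: mphat.
have mwt n z : measurable_fun setT (fun w => prior z * ratio n w z).
  by apply: measurable_funM; [exact: measurable_cst|exact: mratio].
have mtvd n (c : R) :
    measurable [set w | c < tvd (post n w) (fun z => (z == zs)%:R)].
  have mt : measurable_fun setT
      (fun w => tvd (post n w) (fun z => (z == zs)%:R)).
    apply: measurable_funM; first exact: measurable_cst.
    apply: measurable_sum => z; apply: measurableT_comp => //.
    apply: measurable_funB; last exact: measurable_cst.
    apply: measurable_funM; first exact: mwt.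
    by apply: measurable_funV; apply: measurable_sum => z'; exact: mwt.
  rewrite -[X in measurable X]setTI.
  exact: (measurable_fun_ltr (measurable_cst c) mt measurableT
    (Y := [set true])).
have Rc0 : 0 <= Rc by apply: mulr_ge0 => //; exact: bigmax_ge_id.
have [mumin_le0|mumin_gt0] := leP mumin 0%E.
  (* For [mumin <= 0] the exponential is at least one, so [eps = 1] with constant [1 / Rc] fits the
     rate. Here [Rc] is nonzero: an empty minimum would be [+oo], so a supported competitor
     exists. *)
  exists (fun=> 1); split.
    exists Rc^-1; apply: nearW => n; rewrite normr1.
    have Rc_neq0 : Rc != 0.
      have [z /andP[zzs pz]] : exists z, (z != zs) && (0 < prior z).
        apply/existsP; apply: contraPT mumin_le0 => /existsPn no.
        by rewrite /mumin big_pred0// => z; exact: negbTE (no z).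
      rewrite mulf_neq0//.
        rewrite gt_eqF//; apply: lt_le_trans (divr_gt0 pz priors) _.
        exact: (le_bigmax_cond _ (fun z => prior z / prior zs)).
      by rewrite pnatr_eq0 -lt0n; apply/card_gt0P; exists z.
    rewrite mulVf// mul1e -expeR0 lee_expeR oppe_ge0.
    by apply: mule_ge0_le0 => //; rewrite lee_fin !mulr_ge0// ltW.
  rewrite (_ : (fun n => _) = fun=> 0%E); first exact: cvg_cst.
  apply/funext => n; rewrite -[RHS](measure0 P); congr (P _).
  apply/seteqP; split=> w //=; apply: contraPP => _.
  by apply/negP; rewrite -leNgt; exact: (tvd_posterior_le1 zs _ (wt0 n w)).
pose X e : {mfun Om >-> (p.-tuple R * R)%type} :=
  HB.pack (Obs e 0%N) (isMeasurableFun.Build _ _ _ _ _ (mObs e 0%N)).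
(* The law of the first observation serves as [nu e]; [lawObs] identifies it with the density. *)
pose nu e : {measure set (p.-tuple R * R) -> \bar R} := distribution P (X e).
have nuP e A : measurable A ->
    nu e A = intXY (fun x y => (dens e x y)%:E * (((x, y) \in A)%:R)%:E)%E.
  by move=> mA; rewrite -(lawObs e 0%N).
pose lp z := mixE dens (fun e x y => elog (pcond dens e z x y)).
pose lg z := mixE dens (fun e x y => elog (gpool dens z x y)).
have lpfin z : 0 < prior z -> lp z \is a fin_num by move=> /cons[[]].
have lgfin z : 0 < prior z -> lg z \is a fin_num by move=> /cons[_ []].
have muzE z : 0 < prior z -> muz dens z = (fine (lp z) - fine (lg z))%:E.
  move=> pz; have lpz := lpfin z pz; have lgz := lgfin z pz.
  rewrite EFinB (fineK lpz) (fineK lgz).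
  exact: (muz_mixE densP nuP z lpz lgz).
have zs_gap : fine (lp zs) <= fine (lg zs).
  have lpz := lpfin zs priors; have lgz := lgfin zs priors.
  exact: (fine_le lpz lgz (invariant_mixE_le densP nuP zs lpz lgz invar)).
(* A real stand-in for [mumin]. With no supported competitor [mumin] is [+oo]; then [m = 1] works,
   since [Rc] is zero. *)
have [m [m0 gap RcE]] : exists m : R, [/\ 0 < m,
    forall z, z != zs -> 0 < prior z -> m <= fine (lp z) - fine (lg z) &
    Rc = 0 \/ mumin = m%:E].
  have [/existsP[z0 z0P]|no] := boolP [exists z, (z != zs) && (0 < prior z)].
    have mu_le z : z != zs -> 0 < prior z -> (mumin <= muz dens z)%E.
      move=> zzs pz; apply: (@bigmin_le_cond _ _ _ _ z _ (muz dens)).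
      by rewrite zzs.
    have [z0zs pz0] := andP z0P.
    have mufin : mumin \is a fin_num.
      rewrite ge0_fin_numE ?ltW//; apply: le_lt_trans (mu_le _ z0zs pz0) _.
      by rewrite muzE// ltry.
    exists (fine mumin); split; last by right; rewrite fineK.
      by rewrite -lte_fin fineK.
    by move=> z zzs pz; rewrite -lee_fin fineK// -muzE// mu_le.
  move/existsPn in no.
  exists 1; split=> //; first by move=> z zzs pz; move: (no z); rewrite zzs pz.
  left; rewrite /Rc (bigmax_eq_id _ _) ?mul0r// => z zzs.
  move: (no z); rewrite zzs/= lt0r prior0 andbT negbK => /eqP ->.
  by rewrite mul0r.
pose eps n := Rc * expR (- (kappa * n%:R * E%:R * m)).
exists eps; split.
  exists 1; apply: nearW => n.
  have eps0 : 0 <= eps n by exact: mulr_ge0 Rc0 (expR_ge0 _).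
  rewrite mul1r ger0_norm//.
  case: RcE => [Rcz|->]; last by rewrite -EFinM lexx.
  by rewrite /eps Rcz mul0r mul0e.
(* Chosen so that [4 * eta = m - kappa * m], the slack in [gap_perturb]. *)
pose eta := (1 - kappa) * m / 4.
have eta0 : 0 < eta by rewrite divr_gt0// mulr_gt0// subr_gt0.
pose Xp n z w := (((n * E)%:R)^-1%:E *
  \sum_(i < n) \sum_(e < E) elog (phat n e z w (Obs e i w).1 (Obs e i w).2))%E.
pose Xg n z w := (((n * E)%:R)^-1%:E *
  \sum_(i < n) \sum_(e < E) elog (ghat n z w (Obs e i w).1 (Obs e i w).2))%E.
pose Bp n z := bad_event (Xp n z) (fine (lp z)) eta.
pose Bg n z := bad_event (Xg n z) (fine (lg z)) eta.
have mBp : forall n z, measurable (Bp n z).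
  move=> n z; apply: measurable_bad_event; apply: measurable_funeM.
  apply: emeasurable_sum => i; apply: emeasurable_sum => e.
  exact: measurable_elog.
have mBg : forall n z, measurable (Bg n z).
  move=> n z; apply: measurable_bad_event; apply: measurable_funeM.
  apply: emeasurable_sum => i; apply: emeasurable_sum => e.
  exact: measurable_elog.
(* Consistency speaks of supported [z] only; the others have zero posterior weight. *)
pose bad n z := if 0 < prior z then Bp n z `|` Bg n z else set0.
have mbad : forall n z, measurable (bad n z).
  move=> n z; rewrite /bad; case: (0 < prior z); last exact: measurable0.
  exact: measurableU (mBp n z) (mBg n z).
have sub_bad n : (0 < n)%N ->
    [set w | eps n < tvd (post n w) (fun z => (z == zs)%:R)] `<=`
    \big[setU/set0]_z bad n z.
  move=> n0 w /=; apply: contraPP => wbad; apply/negP; rewrite -leNgt.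
  have good z : 0 < prior z -> ~ Bp n z w /\ ~ Bg n z w.
    move=> pz; apply/not_orP => Bw; apply: wbad.
    by rewrite (bigD1 z)//=; left; rewrite /bad pz.
  (* Off the bad events this is the logarithm of [ratio n w z]; undoing the normalisation by [n * E]
     uses [0 < n]. *)
  pose a z := (n * E)%:R * (fine (Xg n z w) - fine (Xp n z w)).
  have N0 : 0 < (n * E)%:R :> R by rewrite ltr0n muln_gt0 n0.
  apply: (@tvd_posterior_le_exp _ _ zs prior (ratio n w) a) => //.
    move=> z pz; have [/contrapT[Xpfin _] /contrapT[Xgfin _]] := good z pz.
    have N'0 : 0 < ((n * E)%:R)^-1 :> R by rewrite invr_gt0.
    have [p0 pE] := elog_mean _ _ _ _ _ N'0 Xpfin.
    have [g0 gE] := elog_mean _ _ _ _ _ N'0 Xgfin.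
    rewrite /a /Xg /Xp pE gE -mulrBr mulrA divff ?gt_eqF// mul1r.
    rewrite -sumrB expR_sum /ratio exchange_big; apply: eq_bigr => i _.
    rewrite -sumrB expR_sum; apply: eq_bigr => e _.
    by rewrite -ln_div ?posrE// lnK// posrE divr_gt0.
  move=> z zzs pz.
  have [/contrapT[_ Xpz] /contrapT[_ Xgz]] := good z pz.
  have [/contrapT[_ Xps] /contrapT[_ Xgs]] := good zs priors.
  rewrite /a -mulrA [E%:R * m]mulrC.
  have -> : kappa * n%:R * (m * E%:R) = (n * E)%:R * (kappa * m).
    by rewrite natrM; ring.
  rewrite -mulrBr ler_pM2l//.
  apply: gap_perturb Xpz Xgz Xps Xgs (gap z zzs pz) zs_gap _.
  by rewrite /eta mulrC divfK// mulrBl mul1r.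
(* There are finitely many [z], so the union bound keeps the limit zero. *)
have prob_bad : (\sum_z P (bad n z))%E @[n --> \oo] --> 0%E.
  have sum0 : (\sum_(z : zset p) (0 : \bar R))%E = 0%E by rewrite big1.
  rewrite -[X in _ --> X]sum0.
  apply: (cvg_nnesum (f := fun z n => P (bad n z)) (l := fun=> 0%E)) => z _.
    by apply: nearW => n; exact: measure_ge0.
  have [pz|npz] := boolP (0 < prior z); last first.
    rewrite (_ : (fun n => _) = fun=> 0%E); first exact: cvg_cst.
    by apply/funext => n; rewrite /bad (negbTE npz) measure0.
  have [[_ cp] [_ cg]] := cons z pz.
  apply: (squeeze_cvge _ (cvg_cst _) (h := fun n => P (Bp n z) + P (Bg n z))%E).
    apply: nearW => n; rewrite measure_ge0 /bad pz /=.
    exact: (measureU2 P (mBp n z) (mBg n z)).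
  rewrite -[X in _ --> X]adde0; apply: cvgeD => //.
    exact: cp.
  exact: cg.
apply: (squeeze_cvge _ (cvg_cst _) prob_bad).
exists 1%N => // n /= n0; rewrite measure_ge0 /=.
apply: le_trans (measure_bigU_le _ _ _ _ _ _ _ (mbad n)).
apply: le_measure; rewrite ?inE//; last exact: sub_bad.
exact: bigsetU_measurable.
Qed.
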